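(* Let $N\in\mathbb{N}$, $N\geq 2$, let $X$ be a compact Hausdorff space, and let $\sigma,\tau_1,\dots,\tau_N\colon X\to X$ be continuous maps such that $\sigma\circ\tau_i=\mathrm{id}_X$ for all $i$, the sets $\tau_1(X),\dots,\tau_N(X)$ are pairwise disjoint, and $\bigcup_{i=1}^{N}\tau_i(X)=X$. Then the operators $$S_i\colon(\varphi,\mu)\longmapsto(\varphi\circ\sigma,\ \mu\circ\tau_i^{-1}),\qquad i=1,\dots,N,$$ are well-defined isometries of the Hilbert space $\mathcal{H}(X)$ satisfying the Cuntz relations $$S_i^{*}S_j=\delta_{i,j}I_{\mathcal{H}(X)},\qquad \sum_{i=1}^{N}S_iS_i^{*}=I_{\mathcal{H}(X)}.$$
   Context: Definition of $\mathcal{H}(X)$, for a compact Hausdorff space $X$. Its elements are equivalence classes of pairs $(\varphi,\mu)$, where $\varphi$ is a complex-valued Borel function on $X$, $\mu$ is a finite positive Borel measure on $X$, and $\int_X|\varphi|^2\,d\mu<\infty$. Two pairs are equivalent, $(\varphi,\mu)\sim(\psi,\nu)$, if there is a finite positive Borel measure $\lambda$ on $X$ with $\mu\ll\lambda$, $\nu\ll\lambda$ and $\varphi\sqrt{d\mu/d\lambda}=\psi\sqrt{d\nu/d\lambda}$ $\lambda$-a.e. The class of $(\varphi,\mu)$ is written $\varphi\sqrt{d\mu}$, or again $(\varphi,\mu)$. Operations: $(\varphi,\mu)+(\psi,\nu)=\bigl(\varphi\sqrt{d\mu/d\lambda}+\psi\sqrt{d\nu/d\lambda},\,\lambda\bigr)$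 and $c(\varphi,\mu)=(c\varphi,\mu)$; inner product $\langle(\varphi,\mu)\mid(\psi,\nu)\rangle=\int_X\bar\varphi\,\psi\sqrt{d\mu/d\lambda}\sqrt{d\nu/d\lambda}\,d\lambda$, for any $\lambda$ with $\mu\ll\lambda$, $\nu\ll\lambda$ (e.g. $\lambda=\mu+\nu$). These are well defined on classes and $\mathcal{H}(X)$ is a complex Hilbert space, with $\|(\varphi,\mu)\|^2=\int_X|\varphi|^2\,d\mu$. For a map $\tau\colon X\to X$, $\mu\circ\tau^{-1}(E):=\mu(\tau^{-1}(E))$ for Borel $E\subset X$, where $\tau^{-1}(E)=\{x\in X: \tau(x)\in E\}$. *)

(* Defs.v *)
From HB Require Import structures.
From mathcomp Require Import all_boot all_order all_algebra.
From mathcomp Require Import all_classical all_reals all_analysis.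
From mathcomp Require Import measurable_realfun.
From mathcomp Require Import complex ring lra.
Import Order.TTheory GRing.Theory Num.Theory numFieldNormedType.Exports.
Set Implicit Arguments.
Unset Strict Implicit.
Unset Printing Implicit Defensive.
Local Open Scope classical_set_scope.
Local Open Scope ring_scope.
Local Open Scope complex_scope.
Local Open Scope charge_scope.

(* Borel sigma-algebras. In the library a measurable type is pointed, so
   [borelType X] is a measurable type only for a nonempty space [X]. *)
Notation borelType X := (g_sigma_algebraType (@open X)).
Notation borelC R := (borelType R[i]^o).

Local Notation Re := complex.Re.
Local Notation Im := complex.Im.
Local Notation normc := ComplexField.Normc.normc.

Section complex_measurable.
Context (R : realType).

Lemma norm_normc (z : R[i]) : `|z| = (normc z)%:C.
Proof. by case: z. Qed.

Lemma normc_leD (a b : R) : normc (a +i* b) <= `|a| + `|b|.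
Proof.
have -> : a +i* b = a%:C + b *i by rewrite /GRing.add /=; rewrite add0r addr0.
apply: (le_trans (le_normcD _ _)).
by rewrite /= !expr0n /= !addr0 add0r !sqrtr_sqr.
Qed.

Lemma ge_normc_Re (z : R[i]) : `|Re z| <= normc z.
Proof. by rewrite -lecR -norm_normc normc_ge_Re. Qed.

Lemma ge_normc_Im (z : R[i]) : `|Im z| <= normc z.
Proof.
case: z => a b /=; rewrite -sqrtr_sqr ler_wsqrtr// lerDr sqr_ge0//.
Qed.

Lemma ReB (y z : R[i]) : Re (y - z) = Re y - Re z.
Proof. by case: y; case: z. Qed.

Lemma ImB (y z : R[i]) : Im (y - z) = Im y - Im z.
Proof. by case: y; case: z. Qed.

Lemma ballC (z : R[i]^o) (e : R) (y : R[i]^o) : ball z e%:C y <-> normc ((z : R[i]) - y) < e.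
Proof. by rewrite -ball_normE /= norm_normc ltcR. Qed.

Let real_part_measurable (f : R[i] -> R) :
    (forall y z, f (y - z) = f y - f z) -> (forall z, `|f z| <= normc z) ->
  measurable_fun [set: borelC R] (f : borelC R -> R).
Proof.
move=> fB fn; apply: (measurability _ (RGenOpens.measurableE R)).
move=> _ [_ [a [b ->]] <-]; rewrite setTI; apply: sub_sigma_algebra.
rewrite openE => z /=; rewrite /interior in_itv /= => /andP[az zb].
apply/nbhs_ballP; exists (Num.min (f z - a) (b - f z))%:C => /=.
  by rewrite ltcR lt_min !subr_gt0 az zb.
move=> y /ballC zy.
have := le_lt_trans (fn _) zy; rewrite lt_min fB => /andP[].
rewrite !ltr_norml => /andP[? ?] /andP[? ?].
by rewrite /= in_itv /=; apply/andP; split; lra.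
Qed.

Lemma Re_measurable : measurable_fun [set: borelC R] (@Re R : borelC R -> R).
Proof. by apply: real_part_measurable; [exact: ReB|exact: ge_normc_Re]. Qed.

Lemma Im_measurable : measurable_fun [set: borelC R] (@Im R : borelC R -> R).
Proof. by apply: real_part_measurable; [exact: ImB|exact: ge_normc_Im]. Qed.

Lemma measurable_complexP d (T : measurableType d) (f : T -> R[i]) :
  measurable_fun [set: T] (f : T -> borelC R) <->
  measurable_fun [set: T] (fun x => Re (f x)) /\
  measurable_fun [set: T] (fun x => Im (f x)).
Proof.
split=> [mf|[mr mi]].
  by split; apply: (measurableT_comp _ mf); [exact: Re_measurable|exact: Im_measurable].
pose rect (q : rat * rat * rat) : set R[i] := [set z |
  `|Re z - ratr q.1.1| < ratr q.2 /\ `|Im z - ratr q.1.2| < ratr q.2].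
apply: (@measurability _ _ T (borelC R) setT f (@open R[i]^o)) => //.
move=> _ [U oU <-]; rewrite setTI.
have -> : U = \bigcup_(q in [set q | rect q `<=` U]) rect q.
  apply/seteqP; split=> [z Uz|z [q /= qU]]; last exact: qU.
  move: (oU); rewrite openE => /(_ _ Uz) /nbhs_ballP [e /= e0 eU].
  have [e' ee' e'0] : exists2 e' : R, e = e'%:C & 0 < e'.
    move: e0; clear eU; case: e => a b; rewrite ltcE /= => /andP[/eqP b0 a0].
    by exists a; rewrite // b0.
  rewrite {}ee' in eU.
  have e40 : 0 < e' / 4 by rewrite divr_gt0.
  have [r] := rat_in_itvoo e40; rewrite in_itv /= => /andP[r0 re].
  have h (x : R) : exists q : rat, `|x - ratr q| < ratr r.
    have : x - ratr r < x + ratr r by lra.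
    move=> /rat_in_itvoo [q]; rewrite in_itv /= => /andP[? ?]; exists q.
    by rewrite ltr_norml; apply/andP; split; lra.
  have [q1 h1] := h (Re z); have [q2 h2] := h (Im z).
  exists (q1, q2, r) => //= y [/= y1 y2]; apply/eU/ballC.
  have -> : z - y = (Re z - Re y) +i* (Im z - Im y) by case: (z); case: (y).
  apply: le_lt_trans (normc_leD _ _) _.
  move: h1 h2 y1 y2; rewrite !ltr_norml => /andP[? ?] /andP[? ?] /andP[? ?] /andP[? ?].
  have : `|Re z - Re y| < e' / 2 by rewrite ltr_norml; apply/andP; split; lra.
  have : `|Im z - Im y| < e' / 2 by rewrite ltr_norml; apply/andP; split; lra.
  lra.
rewrite preimage_bigcup bigcup_mkcond.
apply: countable_bigcupT_measurable => [|q]; first exact: countableP.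
case: ifP => // _.
have -> : f @^-1` rect q =
    ((fun x => Re (f x)) @^-1` `]ratr q.1.1 - ratr q.2, ratr q.1.1 + ratr q.2[) `&`
    ((fun x => Im (f x)) @^-1` `]ratr q.1.2 - ratr q.2, ratr q.1.2 + ratr q.2[).
  by apply/seteqP; split=> x; rewrite /rect /= !in_itv /= !ltr_distl.
by apply: measurableI; rewrite -[X in measurable X]setTI; [apply: mr|apply: mi].
Qed.

End complex_measurable.

Section rnsqrt.
Context d (T : measurableType d) (R : realType).
Implicit Types mu nu la ka : {finite_measure set T -> \bar R}.

(* The square root of d(mu)/d(la). It is only used when mu << la; otherwise
   the library's Radon-Nikodym derivative has the junk value -oo. *)
Definition rnsqrt mu la (x : T) : R :=
  Num.sqrt (fine (('d (charge_of_finite_measure mu) '/d la) x)).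

Lemma null_dominates_ae mu nu (P : T -> Prop) : mu `<< nu ->
  (\forall x \ae nu, P x) -> \forall x \ae mu, P x.
Proof.
move=> /null_content_dominatesP mn [N [mN N0 PN]].
by exists N; split => //; exact: mn.
Qed.

Local Notation rn := Radon_Nikodym_SigmaFinite.f.

Lemma rn_ae mu la : mu `<< la ->
  \forall x \ae la, rn mu la x = ('d (charge_of_finite_measure mu) '/d la) x.
Proof.
move=> mula; have := ae_eq_Radon_Nikodym_SigmaFinite mula measurableT.
by apply: filterS => x; exact.
Qed.

Lemma rnsqrt_ae mu la : mu `<< la ->
  \forall x \ae la, rn mu la x = (rnsqrt mu la x ^+ 2)%:E.
Proof.
move=> mula; apply: filterS (rn_ae mula) => x h.
rewrite /rnsqrt -h sqr_sqrtr ?fineK //.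
  exact: Radon_Nikodym_SigmaFinite.f_fin_num.
by apply: fine_ge0; exact: Radon_Nikodym_SigmaFinite.f_ge0.
Qed.

Lemma measurable_rn mu la : mu `<< la -> measurable_fun setT (rn mu la).
Proof.
move=> mula.
by have /measurable_int := Radon_Nikodym_SigmaFinite.f_integrable mula.
Qed.

Lemma measurable_rnsqrt mu la : mu `<< la ->
  measurable_fun setT (rnsqrt mu la).
Proof.
move=> mula; apply: measurableT_comp.
  by apply: continuous_measurable_fun; exact: sqrt_continuous.
apply: measurableT_comp; first exact: fine_measurable.
by have /measurable_int := @Radon_Nikodym_integrable _ _ _ (charge_of_finite_measure mu) la mula.
Qed.

Lemma rnsqrt_chain mu nu la : mu `<< nu -> nu `<< la ->
  \forall x \ae la, rnsqrt mu la x = rnsqrt mu nu x * rnsqrt nu la x.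
Proof.
move=> munu nula.
have := Radon_Nikodym_chain_rule
  (munu : charge_of_finite_measure mu `<< nu) nula.
apply: filterS2 (rn_ae nula) => x hx /(_ I) /= hc.
rewrite /rnsqrt hc -hx fineM; last 2 first.
- exact: Radon_Nikodym_fin_num.
- exact: Radon_Nikodym_SigmaFinite.f_fin_num.
rewrite mulrC sqrtrM 1?mulrC //.
by apply: fine_ge0; exact: Radon_Nikodym_SigmaFinite.f_ge0.
Qed.

Lemma ae_rnsqrt_neq0 nu la (P : T -> Prop) : nu `<< la ->
  (\forall x \ae nu, P x) <->
  (\forall x \ae la, rnsqrt nu la x != 0 -> P x).
Proof.
move=> nula; split.
- move=> [N [mN N0 PN]].
  have : ae_eq la N (rn nu la) (cst 0%E).
    apply/ae_eq_integral_abs => //; first exact/measurable_funTS/measurable_rn.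
    rewrite -N0 (Radon_Nikodym_SigmaFinite.f_integral nula) //.
    apply: eq_integral => x _; rewrite gee0_abs //.
    exact: Radon_Nikodym_SigmaFinite.f_ge0.
  apply: filterS2 (rnsqrt_ae nula) => x hx hN.
  move/negP => hn; apply: contrapT => nP; apply: hn.
  by move: (hN (PN _ nP)); rewrite hx => -[/eqP]; rewrite sqrf_eq0.
- move=> /(null_dominates_ae nula) h.
  have {}h' := null_dominates_ae nula (rnsqrt_ae nula).
  have hn : \forall x \ae nu, rn nu la x != 0%E.
    exists (rn nu la @^-1` [set 0%E]); split.
    + rewrite -[X in measurable X]setTI; apply: measurable_rn => //.
    + rewrite (Radon_Nikodym_SigmaFinite.f_integral nula) //; last first.
        by rewrite -[X in measurable X]setTI; apply: measurable_rn.
      by rewrite integral0_eq // => x /=.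
    + by move=> x /= /negP; rewrite negbK => /eqP.
  apply: filterS3 h h' hn => x h1 h2 h3; apply: h1.
  by apply: contraNneq h3 => r0; rewrite h2 r0 expr0n.
Qed.

Lemma rnsqrt_change_ge0 nu la (f : T -> R) : nu `<< la ->
  (forall x, 0 <= f x) -> measurable_fun setT f ->
  (\int[la]_x (f x * rnsqrt nu la x ^+ 2)%:E = \int[nu]_x (f x)%:E)%E.
Proof.
move=> nula f0 mf.
have mEf : measurable_fun setT (EFin \o f) by exact/measurable_EFinP.
have f0E x : (0 <= (EFin \o f) x)%E by rewrite lee_fin.
rewrite -[RHS](Radon_Nikodym_SigmaFinite.change_of_variables nula f0E measurableT mEf).
apply: ge0_ae_eq_integral => //.
- apply/measurable_EFinP; apply: measurable_funM => //.
  by apply: measurable_funX; exact: measurable_rnsqrt.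
- apply: emeasurable_funM; first exact/measurable_EFinP.
  exact: measurable_rn.
- by move=> x _; rewrite lee_fin mulr_ge0 // sqr_ge0.
- by move=> x _; rewrite mule_ge0 ?lee_fin //; exact: Radon_Nikodym_SigmaFinite.f_ge0.
- by apply: filterS (rnsqrt_ae nula) => x hx _; rewrite EFinM hx.
Qed.

Lemma rnsqrt_change nu la (f : T -> R) : nu `<< la ->
  nu.-integrable setT (EFin \o f) ->
  \int[la]_x (f x * rnsqrt nu la x ^+ 2) = \int[nu]_x f x.
Proof.
move=> nula fi; rewrite /Rintegral; congr fine.
have mf : measurable_fun setT (EFin \o f) by exact: measurable_int fi.
rewrite -(Radon_Nikodym_change_of_variables nula measurableT fi) //.
apply: ae_eq_integral => //.
- apply/measurable_EFinP; apply: measurable_funM; first exact/measurable_EFinP.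
  by apply: measurable_funX; exact: measurable_rnsqrt.
- by apply: emeasurable_funM.
- have h1 := rnsqrt_ae nula; have h2 := rn_ae nula.
  apply: filterS (filterI h1 h2) => x [{}h1 {}h2] _ /=.
  by rewrite EFinM -h1 h2.
Qed.

End rnsqrt.

Section finite_measure_add.
Context d (T : measurableType d) (R : realType).
Variables mu nu : {finite_measure set T -> \bar R}.

Let measure_add_fin : fin_num_fun (measure_add mu nu).
Proof.
move=> A mA.
by rewrite measure_addE fin_numD; apply/andP; split; exact: fin_num_measure.
Qed.

HB.instance Definition _ := Measure.on (measure_add mu nu).
HB.instance Definition _ :=
  Measure_isFinite.Build _ _ _ (measure_add mu nu) measure_add_fin.

Lemma dominates_addl : mu `<< measure_add mu nu.
Proof.
apply/null_content_dominatesP => A mA /=; rewrite measure_addE => /eqP.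
by rewrite padde_eq0 // => /andP[/eqP].
Qed.

Lemma dominates_addr : nu `<< measure_add mu nu.
Proof.
apply/null_content_dominatesP => A mA /=; rewrite measure_addE => /eqP.
by rewrite padde_eq0 // => /andP[_ /eqP].
Qed.

Lemma dominates_add (la : {finite_measure set T -> \bar R}) :
  mu `<< la -> nu `<< la -> measure_add mu nu `<< la.
Proof.
move=> /null_content_dominatesP ml /null_content_dominatesP nl.
apply/null_content_dominatesP => A mA lA0.
rewrite /= measure_addE -[RHS]adde0.
by congr (_ + _)%E; [exact: ml|exact: nl].
Qed.

End finite_measure_add.
Arguments dominates_addl {d T R} mu nu.
Arguments dominates_addr {d T R} mu nu.

Section sqpair.
Context d (T : measurableType d) (R : realType).

(* [SqPair phi mu] is the pair (phi, mu); its class is phi sqrt(d mu). *)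
Record sqpair := SqPair {
  pfun : T -> R[i] ;
  pmeas : {finite_measure set T -> \bar R} ;
  pfun_measurable : measurable_fun [set: T] (pfun : T -> borelC R) ;
  pfun_square : (\int[pmeas]_x (normc (pfun x) ^+ 2)%:E < +oo)%E }.

HB.instance Definition _ := gen_eqMixin sqpair.
HB.instance Definition _ := gen_choiceMixin sqpair.

(* phi * sqrt(d mu / d la) for p = (phi, mu) *)
Definition dens (p : sqpair) la (x : T) : R[i] :=
  pfun p x * (rnsqrt (pmeas p) la x)%:C.

Definition sq_equiv (p q : sqpair) : Prop :=
  exists la : {finite_measure set T -> \bar R},
    [/\ pmeas p `<< la, pmeas q `<< la &
        \forall x \ae la, dens p la x = dens q la x].

Implicit Types (p q r : sqpair) (la ka : {finite_measure set T -> \bar R}).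

Lemma dens_chain p la ka : pmeas p `<< la -> la `<< ka ->
  \forall x \ae ka, dens p ka x = dens p la x * (rnsqrt la ka x)%:C.
Proof.
move=> pl lk; apply: filterS (rnsqrt_chain pl lk) => x h.
by rewrite /dens h rmorphM /= mulrA.
Qed.

Lemma eq_dens_mono p q la ka :
  pmeas p `<< la -> pmeas q `<< la -> la `<< ka ->
  (\forall x \ae la, dens p la x = dens q la x) <->
  (\forall x \ae ka, dens p ka x = dens q ka x).
Proof.
move=> pl ql lk; have hp := dens_chain pl lk; have hq := dens_chain ql lk.
split.
- move=> /(ae_rnsqrt_neq0 _ lk); apply: filterS3 hp hq => x {}hp {}hq h.
  rewrite hp hq; have [->|/h ->//] := eqVneq (rnsqrt la ka x) 0.
  by rewrite !mulr0.
- move=> h; apply/(ae_rnsqrt_neq0 _ lk); apply: filterS3 hp hq h => x -> -> h r0.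
  by apply: mulIf h; rewrite fmorph_eq0.
Qed.

Lemma sq_equivP p q la : pmeas p `<< la -> pmeas q `<< la ->
  sq_equiv p q <-> \forall x \ae la, dens p la x = dens q la x.
Proof.
move=> pl ql; split=> [[ka [pk qk]]|h]; last by exists la.
move=> /(eq_dens_mono pk qk (dominates_addl ka la)) h.
exact/(eq_dens_mono pl ql (dominates_addr ka la)).
Qed.

Lemma sq_equiv_refl p : sq_equiv p p.
Proof. by exists (pmeas p); split => //; exact: aeW. Qed.

Lemma sq_equiv_sym p q : sq_equiv p q -> sq_equiv q p.
Proof.
move=> [la [pl ql h]]; exists la; split => //.
by apply: filterS h => x ->.
Qed.

Lemma sq_equiv_trans q p r : sq_equiv p q -> sq_equiv q r -> sq_equiv p r.
Proof.
pose la : {finite_measure set T -> \bar R} :=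
  measure_add (measure_add (pmeas p) (pmeas q)) (pmeas r).
have pl : pmeas p `<< la.
  exact: null_dominates_trans (dominates_addl _ _) (dominates_addl _ _).
have ql : pmeas q `<< la.
  exact: null_dominates_trans (dominates_addr _ _) (dominates_addl _ _).
have rl : pmeas r `<< la by exact: dominates_addr.
move=> /(sq_equivP pl ql) h1 /(sq_equivP ql rl) h2.
by apply/(sq_equivP pl rl); apply: filterS2 h1 h2 => x -> ->.
Qed.

Definition sq_equivb p q : bool := `[< sq_equiv p q >].

Lemma sq_equivb_is_equiv : equiv_class_of sq_equivb.
Proof.
split=> [p|p q|q p r].
- exact/asboolP/sq_equiv_refl.
- by apply/asboolP/asboolP; exact: sq_equiv_sym.
- by move=> /asboolP h1 /asboolP h2; apply/asboolP; exact: sq_equiv_trans h1 h2.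
Qed.

Canonical sq_equiv_equiv := EquivRelPack sq_equivb_is_equiv.

Definition hspace := {eq_quot sq_equivb}%qT.
HB.instance Definition _ := Choice.on hspace.

Definition hclass (p : sqpair) : hspace := (\pi_({eq_quot sq_equivb}) p)%qT.
Definition hrepr (x : hspace) : sqpair := repr (x : {eq_quot sq_equivb}%qT).

Lemma hreprK x : hclass (hrepr x) = x.
Proof. exact: reprK. Qed.

Lemma hclassP p q : hclass p = hclass q <-> sq_equiv p q.
Proof.
split; first by move=> /eqmodP /asboolP.
by move=> h; apply/eqmodP/asboolP.
Qed.

End sqpair.

Section complex_lemmas.
Context (R : realType).
Implicit Types (y z : R[i]).

Lemma sqr_normcE z : normc z ^+ 2 = Re z ^+ 2 + Im z ^+ 2.
Proof. by case: z => a b /=; rewrite sqr_sqrtr // addr_ge0 // sqr_ge0. Qed.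

Lemma normc_real (a : R) : normc a%:C = `|a|.
Proof. by rewrite /= expr0n /= addr0 sqrtr_sqr. Qed.

Lemma sqr_normcZ z (a : R) : normc (z * a%:C) ^+ 2 = normc z ^+ 2 * a ^+ 2.
Proof.
by rewrite ComplexField.Normc.normcM normc_real exprMn real_normK ?num_real.
Qed.

Lemma sqr_normcD y z :
  normc (y + z) ^+ 2 <= 2 * normc y ^+ 2 + 2 * normc z ^+ 2.
Proof.
rewrite !sqr_normcE; case: y z => a b [c e] /=.
have := sqr_ge0 (a - c); have := sqr_ge0 (b - e); nra.
Qed.

Context d (T : measurableType d).
Implicit Types f g : T -> R[i].

Lemma measurable_ReP f :
  measurable_fun setT (f : T -> borelC R) -> measurable_fun setT (fun x => Re (f x)).
Proof. by case/measurable_complexP. Qed.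

Lemma measurable_ImP f :
  measurable_fun setT (f : T -> borelC R) -> measurable_fun setT (fun x => Im (f x)).
Proof. by case/measurable_complexP. Qed.

Lemma measurable_cstC z : measurable_fun setT ((fun=> z) : T -> borelC R).
Proof. exact: measurable_cst. Qed.

Lemma measurable_realC (f : T -> R) : measurable_fun setT f ->
  measurable_fun setT ((fun x => (f x)%:C) : T -> borelC R).
Proof.
by move=> mf; apply/measurable_complexP; split => //=; exact: measurable_cst.
Qed.

Lemma measurable_addC f g :
  measurable_fun setT (f : T -> borelC R) ->
  measurable_fun setT (g : T -> borelC R) ->
  measurable_fun setT ((fun x => f x + g x) : T -> borelC R).
Proof.
move=> /measurable_complexP[f1 f2] /measurable_complexP[g1 g2].
apply/measurable_complexP; split.
- rewrite (_ : (fun x => _) = (fun x => Re (f x) + Re (g x))).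
    exact: measurable_funD.
  by apply/funext => x; case: (f x); case: (g x).
- rewrite (_ : (fun x => _) = (fun x => Im (f x) + Im (g x))).
    exact: measurable_funD.
  by apply/funext => x; case: (f x); case: (g x).
Qed.

Lemma measurable_mulC f g :
  measurable_fun setT (f : T -> borelC R) ->
  measurable_fun setT (g : T -> borelC R) ->
  measurable_fun setT ((fun x => f x * g x) : T -> borelC R).
Proof.
move=> /measurable_complexP[f1 f2] /measurable_complexP[g1 g2].
apply/measurable_complexP; split.
- rewrite (_ : (fun x => _) =
    (fun x => Re (f x) * Re (g x) - Im (f x) * Im (g x))).
    by apply: measurable_funB; exact: measurable_funM.
  by apply/funext => x; case: (f x); case: (g x).
- rewrite (_ : (fun x => _) =
    (fun x => Re (f x) * Im (g x) + Im (f x) * Re (g x))).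
    by apply: measurable_funD; exact: measurable_funM.
  by apply/funext => x; case: (f x); case: (g x).
Qed.

Lemma measurable_conjC f :
  measurable_fun setT (f : T -> borelC R) ->
  measurable_fun setT ((fun x => conjc (f x)) : T -> borelC R).
Proof.
move=> /measurable_complexP[f1 f2]; apply/measurable_complexP; split.
- rewrite (_ : (fun x => _) = (fun x => Re (f x))) //.
  by apply/funext => x; case: (f x).
- rewrite (_ : (fun x => _) = (fun x => - Im (f x))) //.
    exact: measurable_funN.
  by apply/funext => x; case: (f x).
Qed.

Lemma measurable_sqr_normc f : measurable_fun setT (f : T -> borelC R) ->
  measurable_fun setT (fun x => normc (f x) ^+ 2).
Proof.
move=> /measurable_complexP[f1 f2].
rewrite (_ : (fun x => _) = (fun x => Re (f x) ^+ 2 + Im (f x) ^+ 2)).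
  by apply: measurable_funD; exact: measurable_funX.
by apply/funext => x; rewrite sqr_normcE.
Qed.

End complex_lemmas.

Section operations.
Context d (T : measurableType d) (R : realType).
Implicit Types (p q r : sqpair T R) (la ka : {finite_measure set T -> \bar R}).
Implicit Types (u v w : hspace T R).

Lemma measurable_dens p la : pmeas p `<< la ->
  measurable_fun setT (dens p la : T -> borelC R).
Proof.
move=> pl; apply: measurable_mulC; first exact: pfun_measurable.
by apply: measurable_realC; exact: measurable_rnsqrt.
Qed.

Lemma dens_square_integral p la : pmeas p `<< la ->
  (\int[la]_x (normc (dens p la x) ^+ 2)%:E =
   \int[pmeas p]_x (normc (pfun p x) ^+ 2)%:E)%E.
Proof.
move=> pl; rewrite -(rnsqrt_change_ge0 pl); last 2 first.
- by move=> x; exact: sqr_ge0.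
- exact/measurable_sqr_normc/pfun_measurable.
by apply: eq_integral => x _; rewrite /dens sqr_normcZ.
Qed.

Lemma dens_square p la : pmeas p `<< la ->
  (\int[la]_x (normc (dens p la x) ^+ 2)%:E < +oo)%E.
Proof. by move=> pl; rewrite dens_square_integral // pfun_square. Qed.

Let add_fun p q (x : T) : R[i] :=
  dens p (measure_add (pmeas p) (pmeas q)) x +
  dens q (measure_add (pmeas p) (pmeas q)) x.

Let add_fun_measurable p q :
  measurable_fun setT (add_fun p q : T -> borelC R).
Proof.
apply: measurable_addC; apply: measurable_dens.
- exact: dominates_addl.
- exact: dominates_addr.
Qed.

Let add_fun_square p q :
  (\int[measure_add (pmeas p) (pmeas q)]_x (normc (add_fun p q x) ^+ 2)%:E
   < +oo)%E.
Proof.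
set la : {finite_measure set T -> \bar R} := measure_add (pmeas p) (pmeas q).
have pl : pmeas p `<< la by exact: dominates_addl.
have ql : pmeas q `<< la by exact: dominates_addr.
pose sq r (x : T) : \bar R := (normc (dens r la x) ^+ 2)%:E.
have msq r : pmeas r `<< la -> measurable_fun setT (sq r).
  by move=> rl; apply/measurable_EFinP/measurable_sqr_normc/measurable_dens.
have sq0 r (x : T) : (0 <= sq r x)%E by rewrite lee_fin sqr_ge0.
apply: (@le_lt_trans _ _ (\int[la]_x (2%:E * sq p x + 2%:E * sq q x))%E).
  apply: ge0_le_integral => //.
  - by move=> x _; rewrite lee_fin sqr_ge0.
  - exact/measurable_EFinP/measurable_sqr_normc/add_fun_measurable.
  - by apply: emeasurable_funD; apply: measurable_funeM; exact: msq.
  - by move=> x _; rewrite -!EFinM -EFinD lee_fin sqr_normcD.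
rewrite ge0_integralD //; last 4 first.
- by move=> x _; rewrite mule_ge0.
- by apply: measurable_funeM; exact: msq.
- by move=> x _; rewrite mule_ge0.
- by apply: measurable_funeM; exact: msq.
rewrite !ge0_integralZl //; [|exact: msq..].
by rewrite lte_add_pinfty // lte_mul_pinfty // dens_square.
Qed.

Definition add_sqpair p q : sqpair T R :=
  SqPair (add_fun_measurable p q) (add_fun_square p q).

Let scale_fun_measurable (c : R[i]) p :
  measurable_fun setT ((fun x => c * pfun p x) : T -> borelC R).
Proof. by apply: measurable_mulC => //; exact: pfun_measurable. Qed.

Let scale_fun_square (c : R[i]) p :
  (\int[pmeas p]_x (normc (c * pfun p x) ^+ 2)%:E < +oo)%E.
Proof.
under eq_integral do rewrite ComplexField.Normc.normcM exprMn EFinM.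
rewrite ge0_integralZl //.
- by rewrite lte_mul_pinfty // ?lee_fin ?sqr_ge0 // pfun_square.
- exact/measurable_EFinP/measurable_sqr_normc/pfun_measurable.
- by move=> x _; rewrite lee_fin sqr_ge0.
- by rewrite lee_fin sqr_ge0.
Qed.

Definition scale_sqpair (c : R[i]) p : sqpair T R :=
  SqPair (scale_fun_measurable c p) (scale_fun_square c p).

Let zero_square :
  (\int[@mzero d T R]_x (normc (0 : R[i]) ^+ 2)%:E < +oo)%E.
Proof. by rewrite integral_measure_zero. Qed.

Definition zero_sqpair : sqpair T R :=
  @SqPair d T R (fun=> 0) (@mzero d T R)
    (@measurable_cstC R d T 0) zero_square.

(* The operations are computed on chosen representatives; [hadd_class],
   [hscale_class] and [hdot_class] below show that the choice is irrelevant
   (and, for the inner product, so is the choice of the dominating measure). *)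
Definition hzero := hclass zero_sqpair.
Definition hadd u v := hclass (add_sqpair (hrepr u) (hrepr v)).
Definition hscale (c : R[i]) u := hclass (scale_sqpair c (hrepr u)).
Definition hopp u := hscale (-1) u.

End operations.

Section hspace_lmodule.
Context d (T : measurableType d) (R : realType).
Implicit Types (p q r : sqpair T R) (la ka : {finite_measure set T -> \bar R}).
Implicit Types (u v w : hspace T R).

Lemma hclass_eq la p q : pmeas p `<< la -> pmeas q `<< la ->
  hclass p = hclass q <-> \forall x \ae la, dens p la x = dens q la x.
Proof. by move=> pl ql; rewrite hclassP; exact: sq_equivP. Qed.

Lemma dens_repr p la : pmeas p `<< la -> pmeas (hrepr (hclass p)) `<< la ->
  \forall x \ae la, dens (hrepr (hclass p)) la x = dens p la x.
Proof. by move=> pl rl; apply/(hclass_eq rl pl); rewrite hreprK. Qed.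

Lemma dens_add p q la : pmeas p `<< la -> pmeas q `<< la ->
  \forall x \ae la, dens (add_sqpair p q) la x = dens p la x + dens q la x.
Proof.
move=> pl ql; set mn : {finite_measure set T -> \bar R} :=
  measure_add (pmeas p) (pmeas q).
have ml : mn `<< la by exact: dominates_add.
have hp := dens_chain (dominates_addl _ _ : pmeas p `<< mn) ml.
have hq := dens_chain (dominates_addr _ _ : pmeas q `<< mn) ml.
by apply: filterS2 hp hq => x -> ->; rewrite -mulrDl.
Qed.

Lemma dens_scale c p la x : dens (scale_sqpair c p) la x = c * dens p la x.
Proof. by rewrite /dens /= mulrA. Qed.

Lemma dens_zero la x : dens (zero_sqpair T R) la x = 0.
Proof. by rewrite /dens /= mul0r. Qed.

Lemma dominates_zero la : pmeas (zero_sqpair T R) `<< la.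
Proof. by apply/null_content_dominatesP => A mA _. Qed.


Lemma dominates_scale c p la :
  pmeas p `<< la -> pmeas (scale_sqpair c p) `<< la.
Proof. by []. Qed.

Lemma dominates_add_sqpair p q la : pmeas p `<< la -> pmeas q `<< la ->
  pmeas (add_sqpair p q) `<< la.
Proof. exact: dominates_add. Qed.

Lemma dominating2 p q : exists la, pmeas p `<< la /\ pmeas q `<< la.
Proof.
exists (measure_add (pmeas p) (pmeas q)).
by split; [exact: dominates_addl|exact: dominates_addr].
Qed.

Lemma dominating4 p q r s : exists la, [/\ pmeas p `<< la, pmeas q `<< la,
  pmeas r `<< la & pmeas s `<< la].
Proof.
have [l1 [p1 q1]] := dominating2 p q; have [l2 [r2 s2]] := dominating2 r s.
exists (measure_add l1 l2).
split; (apply: null_dominates_trans; [eassumption|]);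
  by [exact: dominates_addl|exact: dominates_addr].
Qed.

Lemma hadd_class p q : hadd (hclass p) (hclass q) = hclass (add_sqpair p q).
Proof.
rewrite /hadd.
have [la [pl ql pl' ql']] :=
  dominating4 p q (hrepr (hclass p)) (hrepr (hclass q)).
apply/(hclass_eq (dominates_add_sqpair pl' ql') (dominates_add_sqpair pl ql)).
have hp := dens_repr pl pl'; have hq := dens_repr ql ql'.
have h1 := dens_add pl ql; have h2 := dens_add pl' ql'.
by apply: filterS2 (filterI hp hq) (filterI h1 h2) => x [{}hp {}hq] [-> ->]; rewrite hp hq.
Qed.

Lemma hscale_class c p : hscale c (hclass p) = hclass (scale_sqpair c p).
Proof.
rewrite /hscale.
have [la [pl pl']] := dominating2 p (hrepr (hclass p)).
apply/(hclass_eq (dominates_scale c pl') (dominates_scale c pl)).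
by apply: filterS (dens_repr pl pl') => x; rewrite !dens_scale => ->.
Qed.

Lemma haddA : associative (@hadd d T R).
Proof.
move=> u v w; rewrite -(hreprK u) -(hreprK v) -(hreprK w) !hadd_class.
move: (hrepr u) (hrepr v) (hrepr w) => p q r.
have [la [pl ql rl _]] := dominating4 p q r r.
have pql := dominates_add_sqpair pl ql; have qrl := dominates_add_sqpair ql rl.
apply/(hclass_eq (dominates_add_sqpair pl qrl) (dominates_add_sqpair pql rl)).
apply: filterS2 (filterI (dens_add pl qrl) (dens_add ql rl))
  (filterI (dens_add pql rl) (dens_add pl ql)) => x [-> ->] [-> ->].
exact: addrA.
Qed.

Lemma haddC : commutative (@hadd d T R).
Proof.
move=> u v; rewrite -(hreprK u) -(hreprK v) !hadd_class.
move: (hrepr u) (hrepr v) => p q.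
have [la [pl ql]] := dominating2 p q.
apply/(hclass_eq (dominates_add_sqpair pl ql) (dominates_add_sqpair ql pl)).
apply: filterS2 (dens_add pl ql) (dens_add ql pl) => x -> ->.
exact: addrC.
Qed.

Lemma hadd0 : left_id (hzero T R) (@hadd d T R).
Proof.
move=> u; rewrite -(hreprK u) hadd_class; move: (hrepr u) => p.
have [la [pl zl]] := dominating2 p (zero_sqpair T R).
apply/(hclass_eq (dominates_add_sqpair zl pl) pl).
by apply: filterS (dens_add zl pl) => x ->; rewrite dens_zero add0r.
Qed.

Lemma hscale_hadd_eq c1 c2 c p :
  c1 + c2 = c ->
  hadd (hscale c1 (hclass p)) (hscale c2 (hclass p)) = hscale c (hclass p).
Proof.
move=> <-; rewrite !hscale_class hadd_class.
have [la [pl _]] := dominating2 p p.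
have p1 := dominates_scale c1 pl; have p2 := dominates_scale c2 pl.
apply/(hclass_eq (dominates_add_sqpair p1 p2) (dominates_scale (c1 + c2) pl)).
by apply: filterS (dens_add p1 p2) => x ->; rewrite !dens_scale mulrDl.
Qed.

Lemma hscale1 : left_id 1 (@hscale d T R).
Proof.
move=> u; rewrite -(hreprK u) hscale_class; move: (hrepr u) => p.
have [la [pl _]] := dominating2 p p.
apply/(hclass_eq (dominates_scale 1 pl) pl); apply: aeW => x.
by rewrite dens_scale mul1r.
Qed.

Lemma hscaleA a b u : hscale a (hscale b u) = hscale (a * b) u.
Proof.
rewrite -(hreprK u) !hscale_class; move: (hrepr u) => p.
have [la [pl _]] := dominating2 p p.
apply/(hclass_eq (dominates_scale a (dominates_scale b pl))
  (dominates_scale (a * b) pl)).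
by apply: aeW => x; rewrite !dens_scale mulrA.
Qed.

Lemma hscaleDr : right_distributive (@hscale d T R) (@hadd d T R).
Proof.
move=> c u v; rewrite -(hreprK u) -(hreprK v).
move: (hrepr u) (hrepr v) => p q; rewrite !(hscale_class, hadd_class).
have [la [pl ql]] := dominating2 p q.
have cp := dominates_scale c pl; have cq := dominates_scale c ql.
apply/(hclass_eq (dominates_scale c (dominates_add_sqpair pl ql))
  (dominates_add_sqpair cp cq)).
apply: filterS2 (dens_add pl ql) (dens_add cp cq) => x h ->.
by rewrite !dens_scale h mulrDr.
Qed.

Lemma hscaleDl u : {morph (@hscale d T R)^~ u : a b / a + b >-> hadd a b}.
Proof. by move=> a b; rewrite -(hreprK u); exact/esym/hscale_hadd_eq. Qed.

Lemma hscale0 u : hscale 0 u = hzero T R.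
Proof.
rewrite -(hreprK u) hscale_class; move: (hrepr u) => p.
have [la [pl zl]] := dominating2 p (zero_sqpair T R).
apply/(hclass_eq (dominates_scale 0 pl) zl); apply: aeW => x.
by rewrite dens_scale dens_zero mul0r.
Qed.

Lemma haddN : left_inverse (hzero T R) (@hopp d T R) (@hadd d T R).
Proof.
move=> u; rewrite /hopp -{2}(hscale1 u) -hscaleDl addNr; exact: hscale0.
Qed.

HB.instance Definition _ :=
  GRing.isZmodule.Build (hspace T R) haddA haddC hadd0 haddN.
HB.instance Definition _ :=
  GRing.Zmodule_isLmodule.Build R[i] (hspace T R) hscaleA hscale1 hscaleDr hscaleDl.

End hspace_lmodule.

Section hdot.
Context d (T : measurableType d) (R : realType).
Implicit Types (p q r : sqpair T R) (la ka : {finite_measure set T -> \bar R}).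
Implicit Types (u v w : hspace T R).

Lemma conjc_realZ (z : R[i]) (a : R) : conjc (z * a%:C) = conjc z * a%:C.
Proof. by case: z => x y; congr (_ +i* _) => /=; ring. Qed.

Definition cintegral la (f : T -> R[i]) : R[i] :=
  (\int[la]_x Re (f x)) +i* (\int[la]_x Im (f x)).

Definition sqdot la p q : R[i] :=
  cintegral la (fun x => conjc (pfun p x) * pfun q x *
    (rnsqrt (pmeas p) la x)%:C * (rnsqrt (pmeas q) la x)%:C).

(* conjugate-linear in the first argument, linear in the second *)
Definition hdot u v : R[i] :=
  sqdot (measure_add (pmeas (hrepr u)) (pmeas (hrepr v))) (hrepr u) (hrepr v).

Definition hnorm u : R := Num.sqrt (Re (hdot u u)).

Lemma sqdotE la p q :
  sqdot la p q = cintegral la (fun x => conjc (dens p la x) * dens q la x).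
Proof.
rewrite /sqdot /dens; congr cintegral; apply/funext => x.
by rewrite conjc_realZ; ring.
Qed.

Lemma cintegrable_dens la p q : pmeas p `<< la -> pmeas q `<< la ->
  la.-integrable setT (EFin \o (fun x => Re (conjc (dens p la x) * dens q la x))) /\
  la.-integrable setT (EFin \o (fun x => Im (conjc (dens p la x) * dens q la x))).
Proof.
move=> pl ql.
have mf : measurable_fun setT
    ((fun x => conjc (dens p la x) * dens q la x) : T -> borelC R).
  by apply: measurable_mulC; [apply: measurable_conjC|]; exact: measurable_dens.
pose b (x : T) := normc (dens p la x) ^+ 2 + normc (dens q la x) ^+ 2.
have isq r : pmeas r `<< la ->
    la.-integrable setT (EFin \o (fun x => normc (dens r la x) ^+ 2)).
  move=> rl; apply/integrableP; split.
    exact/measurable_EFinP/measurable_sqr_normc/measurable_dens.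
  apply: le_lt_trans (dens_square rl); apply: ge0_le_integral => //.
  - apply: measurableT_comp => //.
    exact/measurable_EFinP/measurable_sqr_normc/measurable_dens.
  - exact/measurable_EFinP/measurable_sqr_normc/measurable_dens.
  - by move=> x _; rewrite /= ger0_norm // sqr_ge0.
have ib : la.-integrable setT (EFin \o b).
  exact: (integrableD measurableT (isq p pl) (isq q ql)).
have bound (a : R) x : `|a| <= normc (conjc (dens p la x) * dens q la x) ->
    (`|a%:E| <= `|(EFin \o b) x|)%E.
  rewrite ComplexField.Normc.normcM /= => h.
  rewrite lee_fin (le_trans h) // (ger0_norm (addr_ge0 _ _)) ?sqr_ge0 //.
  have -> : normc (conjc (dens p la x)) = normc (dens p la x).
    by case: (dens p la x) => ? ? /=; rewrite sqrrN.
  rewrite /b; set s := normc _; set t := normc _.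
  by have := sqr_ge0 (s - t); have := sqr_ge0 (s + t); nra.
split; apply: (le_integrable measurableT _ _ ib).
- exact/measurable_EFinP/(measurable_ReP mf).
- by move=> x _; apply: bound; exact: ge_normc_Re.
- exact/measurable_EFinP/(measurable_ImP mf).
- by move=> x _; apply: bound; exact: ge_normc_Im.
Qed.

Lemma measurable_dot_dens la p q : pmeas p `<< la -> pmeas q `<< la ->
  measurable_fun setT
    ((fun x => conjc (dens p la x) * dens q la x) : T -> borelC R).
Proof.
move=> pl ql.
by apply: measurable_mulC; [apply: measurable_conjC|]; exact: measurable_dens.
Qed.

Lemma ae_eq_cintegral la (f g : T -> R[i]) :
  measurable_fun setT (f : T -> borelC R) ->
  measurable_fun setT (g : T -> borelC R) ->
  (\forall x \ae la, f x = g x) -> cintegral la f = cintegral la g.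
Proof.
move=> mf mg fg; rewrite /cintegral /Rintegral; congr (fine _ +i* fine _).
- apply: ae_eq_integral => //.
  + exact/measurable_EFinP/(measurable_ReP mf).
  + exact/measurable_EFinP/(measurable_ReP mg).
  + by apply: filterS fg => x ->.
- apply: ae_eq_integral => //.
  + exact/measurable_EFinP/(measurable_ImP mf).
  + exact/measurable_EFinP/(measurable_ImP mg).
  + by apply: filterS fg => x ->.
Qed.

Lemma sqdot_mono la ka p q : pmeas p `<< la -> pmeas q `<< la -> la `<< ka ->
  sqdot ka p q = sqdot la p q.
Proof.
move=> pl ql lk; rewrite !sqdotE.
have pk := null_dominates_trans pl lk; have qk := null_dominates_trans ql lk.
have [iR iI] := cintegrable_dens pl ql.
rewrite [RHS]/cintegral -(rnsqrt_change lk iR) -(rnsqrt_change lk iI).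
pose s (x : T) := rnsqrt la ka x ^+ 2.
transitivity (cintegral ka (fun x => conjc (dens p la x) * dens q la x * (s x)%:C)).
  apply: ae_eq_cintegral.
  - exact: measurable_dot_dens.
  - apply: measurable_mulC; first exact: measurable_dot_dens.
    by apply/measurable_realC/measurable_funX/measurable_rnsqrt.
  - apply: filterS2 (dens_chain pl lk) (dens_chain ql lk) => x -> ->.
    by rewrite conjc_realZ /s rmorphXn /=; ring.
rewrite /cintegral; congr (_ +i* _); apply: eq_Rintegral => x _.
- by case: (_ * dens q la x) => a b /=; rewrite mulr0 subr0.
- by case: (_ * dens q la x) => a b /=; rewrite mulr0 add0r.
Qed.

Lemma sqdot_indep la ka p q : pmeas p `<< la -> pmeas q `<< la ->
  pmeas p `<< ka -> pmeas q `<< ka -> sqdot la p q = sqdot ka p q.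
Proof.
move=> pl ql pk qk.
rewrite -(sqdot_mono pl ql (dominates_addl la ka)).
exact: sqdot_mono pk qk (dominates_addr la ka).
Qed.

Lemma hdot_class la p q : pmeas p `<< la -> pmeas q `<< la ->
  hdot (hclass p) (hclass q) = sqdot la p q.
Proof.
move=> pl ql; rewrite /hdot.
have [ka [pk qk pk' qk']] :=
  dominating4 p q (hrepr (hclass p)) (hrepr (hclass q)).
rewrite (sqdot_indep pl ql pk qk).
rewrite (sqdot_indep (dominates_addl _ _) (dominates_addr _ _) pk' qk') !sqdotE.
apply: ae_eq_cintegral; [exact: measurable_dot_dens..|].
by apply: filterS2 (dens_repr pk pk') (dens_repr qk qk') => x -> ->.
Qed.

Lemma hdotDr u v w : hdot u (v + w) = hdot u v + hdot u w.
Proof.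
rewrite -(hreprK u) -(hreprK v) -(hreprK w).
move: (hrepr u) (hrepr v) (hrepr w) => p q r.
have [la [pl ql rl _]] := dominating4 p q r r.
have qrl := dominates_add_sqpair ql rl.
rewrite [_ + _](hadd_class q r) (hdot_class pl qrl) (hdot_class pl ql).
rewrite (hdot_class pl rl) !sqdotE.
have [aR aI] := cintegrable_dens pl ql; have [bR bI] := cintegrable_dens pl rl.
transitivity (cintegral la (fun x => conjc (dens p la x) * dens q la x +
    conjc (dens p la x) * dens r la x)).
  apply: ae_eq_cintegral; [exact: measurable_dot_dens| |].
    by apply: measurable_addC; exact: measurable_dot_dens.
  by apply: filterS (dens_add ql rl) => x ->; rewrite mulrDr.
rewrite /cintegral {3}/GRing.add /= -!RintegralD //.
by congr (_ +i* _); apply: eq_Rintegral => x _; case: (_ * dens q la x);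
  case: (_ * dens r la x).
Qed.

Lemma hdotZr c u v : hdot u (c *: v) = c * hdot u v.
Proof.
rewrite -(hreprK u) -(hreprK v); move: (hrepr u) (hrepr v) => p q.
have [la [pl ql]] := dominating2 p q.
have cql := dominates_scale c ql.
rewrite [_ *: _](hscale_class c q) (hdot_class pl cql) (hdot_class pl ql).
rewrite !sqdotE; have [aR aI] := cintegrable_dens pl ql.
case: c cql => a b cql.
pose I1 := \int[la]_x Re (conjc (dens p la x) * dens q la x).
pose I2 := \int[la]_x Im (conjc (dens p la x) * dens q la x).
transitivity ((a * I1 - b * I2) +i* (a * I2 + b * I1)); last by [].
have iZ k (f : T -> R) : la.-integrable setT (EFin \o f) ->
    la.-integrable setT (EFin \o (fun x => k * f x)).
  by move=> fi; exact: (integrableZl measurableT k fi).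
rewrite /I1 /I2 -!RintegralZl // -RintegralB //; [|exact: iZ..].
rewrite -RintegralD //; [|exact: iZ..].
by congr (_ +i* _); apply: eq_Rintegral => x _; rewrite dens_scale mulrCA;
  case: (_ * dens q la x).
Qed.

Lemma hdotC u v : hdot u v = conjc (hdot v u).
Proof.
rewrite -(hreprK u) -(hreprK v); move: (hrepr u) (hrepr v) => p q.
have [la [pl ql]] := dominating2 p q.
rewrite (hdot_class pl ql) (hdot_class ql pl) !sqdotE /cintegral /=.
have [aR aI] := cintegrable_dens ql pl.
congr (_ +i* _).
  apply: eq_Rintegral => x _.
  by case: (dens p la x); case: (dens q la x) => a b c e /=; ring.
rewrite -[RHS]mulN1r -RintegralZl //.
apply: eq_Rintegral => x _.
by case: (dens p la x); case: (dens q la x) => a b c e /=; ring.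
Qed.

Lemma hdot_classxx p :
  hdot (hclass p) (hclass p) = (\int[pmeas p]_x (normc (pfun p x) ^+ 2))%:C.
Proof.
have [la [pl _]] := dominating2 p p.
rewrite (hdot_class pl pl) sqdotE /Rintegral -(dens_square_integral pl).
rewrite /cintegral /Rintegral; congr (_ +i* _).
- congr fine; apply: eq_integral => x _; rewrite sqr_normcE.
  by case: (dens p la x) => a b /=; congr EFin; ring.
- rewrite (_ : (\int[la]_x _)%E = 0%E) // integral0_eq // => x _.
  by case: (dens p la x) => a b /=; congr EFin; ring.
Qed.

Lemma hnorm_class p :
  hnorm (hclass p) ^+ 2 = \int[pmeas p]_x (normc (pfun p x) ^+ 2).
Proof.
rewrite /hnorm hdot_classxx /= sqr_sqrtr //.
by apply: Rintegral_ge0 => x _; exact: sqr_ge0.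
Qed.

Lemma hdot_ge0 u : 0 <= hdot u u.
Proof.
rewrite -(hreprK u) hdot_classxx ler0c.
by apply: Rintegral_ge0 => x _; exact: sqr_ge0.
Qed.

Lemma hdot_eq0 u : hdot u u = 0 -> u = 0.
Proof.
rewrite -(hreprK u) hdot_classxx; move: (hrepr u) => p /complexI h.
have [la [pl zl]] := dominating2 p (zero_sqpair T R).
have sfin : (\int[pmeas p]_x (normc (pfun p x) ^+ 2)%:E)%E \is a fin_num.
  rewrite ge0_fin_numE ?pfun_square // integral_ge0 // => x _.
  by rewrite lee_fin sqr_ge0.
have {}h : (\int[la]_x (normc (dens p la x) ^+ 2)%:E = 0)%E.
  by rewrite (dens_square_integral pl) -(fineK sfin) -[fine _]/(Rintegral _ _ _) h.
apply/(hclass_eq pl zl).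
have : ae_eq la setT (fun x => (normc (dens p la x) ^+ 2)%:E) (cst 0%E).
  apply/ae_eq_integral_abs => //.
    exact/measurable_EFinP/measurable_sqr_normc/measurable_dens.
  rewrite -h; apply: eq_integral => x _.
  by rewrite gee0_abs // lee_fin sqr_ge0.
apply: filterS => x /(_ I) [] /eqP; rewrite sqrf_eq0 => /eqP h0.
by rewrite dens_zero; exact: ComplexField.Normc.eq0_normc.
Qed.

(* [B] is the adjoint of [A]; it is unique by [hdot_eq0]. *)
Definition is_adjoint (A B : hspace T R -> hspace T R) : Prop :=
  forall u v, hdot (A u) v = hdot u (B v).

End hdot.

Notation calH R X := (hspace (borelType X) R).

(* Main.v *)
(* If [g] is a left inverse of [f] on a measurable set [D], the map sending
   (phi, mu) to (phi o g, (mu restricted to D) o f^-1) acts on densities as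
   composition with [g]: by uniqueness of Radon-Nikodym derivatives, when mu << la
   the derivative of the image of mu with respect to the image of la is
   (d mu / d la) o g. Hence it descends to a linear map on classes.
   S_i is the case f = tau_i, g = sigma, D = X, and S_i^* is the case f = sigma,
   g = tau_i, D = tau_i(X). Since S_i S_i^* is the restriction to tau_i(X) and
   these sets partition X, the S_i S_i^* sum to the identity; adjointness then
   follows by expanding v = sum_j S_j S_j^* v in <S_i u | v>, as the S_i are
   isometries with pairwise orthogonal ranges. *)
Require Import Defs.
From HB Require Import structures.
From mathcomp Require Import all_boot all_order all_algebra.
From mathcomp Require Import all_classical all_reals all_analysis.
From mathcomp Require Import measurable_realfun.
From mathcomp Require Import complex.
Import Order.TTheory GRing.Theory Num.Theory numFieldNormedType.Exports.
Set Implicit Arguments.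
Unset Strict Implicit.
Unset Printing Implicit Defensive.
Local Open Scope classical_set_scope.
Local Open Scope ring_scope.
Local Open Scope charge_scope.

Local Notation normc := ComplexField.Normc.normc.

(** * Uniqueness of square-root densities, and densities of restricted measures *)

Section rnsqrt_uniqueness.
Context d (T : measurableType d) (R : realType).
Implicit Types mu la : {finite_measure set T -> \bar R}.

Lemma density_dominates mu la (h : T -> \bar R) : measurable_fun setT h ->
  (forall A, measurable A -> mu A = \int[la]_(x in A) h x)%E -> mu `<< la.
Proof.
move=> mh muE; apply/null_content_dominatesP => A mA la0.
by rewrite muE // null_set_integral //; exact: measurable_funTS.
Qed.

(** The derivative of [mu] and [h ^+ 2] have equal [la]-integrals over every measurable set, so they
    agree almost everywhere; since [h] is nonnegative, the square root returns [h] itself. *)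
Lemma rnsqrt_unique mu la (h : T -> R) :
  measurable_fun setT h -> (forall x, 0 <= h x) ->
  (forall A, measurable A -> mu A = \int[la]_(x in A) (h x ^+ 2)%:E)%E ->
  \forall x \ae la, rnsqrt mu la x = h x.
Proof.
move=> mh h0 muE.
have mh2 : measurable_fun setT (fun x => (h x ^+ 2)%:E).
  exact/measurable_EFinP/measurable_funX.
have mula := density_dominates mh2 muE.
have : ae_eq la setT ('d (charge_of_finite_measure mu) '/d la)
    (fun x => (h x ^+ 2)%:E).
  apply: integral_ae_eq => //; first exact: Radon_Nikodym_integrable.
  by move=> A _ mA; rewrite -Radon_Nikodym_integral //; exact: muE.
apply: filterS => x /(_ I) hx.
by rewrite /rnsqrt hx /= sqrtr_sqr ger0_norm.
Qed.

Lemma dominates_mrestr la (D : set T) (mD : measurable D) : mrestr la mD `<< la.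
Proof.
apply/null_content_dominatesP => A mA A0; apply/eqP.
rewrite eq_le measure_ge0 andbT -A0 /mrestr.
by apply: le_measure => //; rewrite inE //; exact: measurableI.
Qed.

Lemma rnsqrt_indic mu la (D : set T) : measurable D ->
  (forall A, measurable A -> mu A = la (A `&` D)) ->
  \forall x \ae la, rnsqrt mu la x = \1_D x.
Proof.
move=> mD muE; apply: rnsqrt_unique => // A mA.
under eq_integral do rewrite indicE -natrX -mulnn mulnb andbb -indicE.
by rewrite muE // integral_indic // setIC.
Qed.

(** The restriction has density [\1_D] with respect to [la], and an indicator is its own square, so
    this is a change of variables. *)
Lemma ge0_integral_mrestr la (D A : set T) (mD : measurable D) (h : T -> R) :
  measurable A -> measurable_fun setT h -> (forall x, 0 <= h x) ->
  (\int[mrestr la mD]_(x in A) (h x)%:E = \int[la]_(x in A `&` D) (h x)%:E)%E.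
Proof.
move=> mA mh h0; pose hA x := h x * \1_A x.
have mhA : measurable_fun setT hA by exact: measurable_funM.
have hA0 x : 0 <= hA x by rewrite mulr_ge0 // indicE.
transitivity (\int[mrestr la mD]_x (hA x)%:E)%E.
  by rewrite integral_mkcond epatch_indic; apply: eq_integral => x _.
rewrite -(rnsqrt_change_ge0 (dominates_mrestr mD) hA0 mhA).
transitivity (\int[la]_x (h x * \1_(A `&` D) x)%:E)%E; last first.
  by rewrite [RHS]integral_mkcond epatch_indic; apply: eq_integral => x _.
apply: ge0_ae_eq_integral => //.
- apply/measurable_EFinP; apply: measurable_funM => //.
  exact/measurable_funX/measurable_rnsqrt/dominates_mrestr.
- apply/measurable_EFinP; apply: measurable_funM => //.
  exact/measurable_indic/measurableI.
- by move=> x _; rewrite lee_fin mulr_ge0 // sqr_ge0.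
- by move=> x _; rewrite lee_fin mulr_ge0 // indicE.
- have rD : \forall x \ae la, rnsqrt (mrestr la mD) la x = \1_D x.
    exact: rnsqrt_indic.
  apply: filterS rD => x -> _; congr EFin.
  by rewrite /hA indicI /= -mulrA !indicE; do 2 case: (_ \in _);
    rewrite ?(mul0r, mulr0, mulr1, expr1n, expr0n).
Qed.

End rnsqrt_uniqueness.

(* [mf] does not occur in the value; it is an argument so that the measure
   structure of [transport mf mD mu] can be inferred. *)
Definition transport d1 d2 (T1 : measurableType d1) (T2 : measurableType d2)
    (R : realType) (f : T1 -> T2) (D : set T1)
    (mf : measurable_fun setT f) (mD : measurable D)
    (mu : {finite_measure set T1 -> \bar R}) : set T2 -> \bar R :=
  pushforward (mrestr mu mD) f.

(** * Images of restricted measures under a map with a left inverse on [D] *)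

Section transport_measure.
Context d1 d2 (T1 : measurableType d1) (T2 : measurableType d2) (R : realType).
Context (f : T1 -> T2) (D : set T1).
Hypotheses (mf : measurable_fun setT f) (mD : measurable D).
Implicit Types mu la : {finite_measure set T1 -> \bar R}.

Local Notation tm := (transport mf mD).

Let measurable_pre (A : set T2) : measurable A -> measurable (f @^-1` A).
Proof. by move=> mA; rewrite -[X in measurable X]setTI; exact: mf. Qed.

Section instances.
Variable mu : {finite_measure set T1 -> \bar R}.

HB.instance Definition _ := Measure.copy (tm mu)
  (@measure_function_pushforward__canonical__measure_function_Measure
    _ _ _ _ _ (mrestr mu mD) _ mf).

Let transport_fin : fin_num_fun (tm mu).
Proof.
by move=> A mA; apply: (fin_num_measure (mrestr mu mD)); exact: measurable_pre.
Qed.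

HB.instance Definition _ :=
  Measure_isFinite.Build _ _ _ (tm mu) transport_fin.

End instances.

Lemma ge0_integral_transport mu (A : set T2) (h : T2 -> R) :
  measurable A -> measurable_fun setT h -> (forall y, 0 <= h y) ->
  (\int[tm mu]_(y in A) (h y)%:E =
   \int[mu]_(x in f @^-1` A `&` D) (h (f x))%:E)%E.
Proof.
move=> mA mh h0.
rewrite [LHS](ge0_integral_pushforward mf (mrestr mu mD)) //.
- apply: (ge0_integral_mrestr _ _ (h := h \o f)) => //.
  + exact: measurable_pre.
  + exact: measurableT_comp.
  + by move=> x; exact: h0.
- exact/measurable_funTS/measurable_EFinP.
- by move=> y _; rewrite lee_fin.
Qed.

Lemma dominates_transport mu la : mu `<< la -> tm mu `<< tm la.
Proof.
move=> /null_content_dominatesP mula; apply/null_content_dominatesP => A mA.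
by apply: mula; apply: measurableI => //; exact: measurable_pre.
Qed.

Variable g : T2 -> T1.
Hypotheses (mg : measurable_fun setT g) (fK : forall x, D x -> g (f x) = x).

Lemma transport_ae la (P : T1 -> Prop) :
  (\forall x \ae la, P x) -> \forall y \ae tm la, P (g y).
Proof.
move=> [N [mN N0 PN]]; exists (g @^-1` N); split.
- by rewrite -[X in measurable X]setTI; exact: mg.
- apply/eqP; rewrite eq_le measure_ge0 andbT -N0 /transport /pushforward /mrestr.
  apply: le_measure; rewrite ?inE //.
    apply: measurableI => //; apply: measurable_pre.
    by rewrite -[X in measurable X]setTI; exact: mg.
  by move=> x [/= + Dx]; rewrite fK.
- by move=> y /= nP; exact: PN.
Qed.

(** By uniqueness it suffices to integrate the square of the right-hand side over [A]. Pulled back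
    along [f], this is the integral of the derivative of [mu] over the part of [D] that [f] sends
    into [A], where [g (f x) = x]. *)
Lemma rnsqrt_transport mu la : mu `<< la ->
  \forall y \ae tm la,
    rnsqrt (tm mu) (tm la) y = rnsqrt mu la (g y).
Proof.
move=> mula; apply: rnsqrt_unique.
- by apply: measurableT_comp => //; exact: measurable_rnsqrt.
- by move=> y; exact: sqrtr_ge0.
- move=> A mA.
  have mfA : measurable (f @^-1` A `&` D).
    by apply: measurableI => //; exact: measurable_pre.
  rewrite (ge0_integral_transport _ (h := fun y => rnsqrt mu la (g y) ^+ 2)) //;
    first last.
  + by move=> y; exact: sqr_ge0.
  + apply: measurable_funX; apply: measurableT_comp => //.
    exact: measurable_rnsqrt.
  transitivity (mu (f @^-1` A `&` D)) => //.
  rewrite (Radon_Nikodym_SigmaFinite.f_integral mula) //.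
  apply: ge0_ae_eq_integral => //.
  + exact/measurable_funTS/measurable_rn.
  + apply/measurable_funTS/measurable_EFinP/measurable_funX.
    apply: (measurableT_comp (measurable_rnsqrt mula)).
    exact: measurableT_comp.
  + by move=> x _; exact: Radon_Nikodym_SigmaFinite.f_ge0.
  + by move=> x _; rewrite lee_fin sqr_ge0.
  + by apply: filterS (rnsqrt_ae mula) => x -> [_ Dx]; rewrite fK.
Qed.

(** * The induced linear map on classes *)

Section transport_pair.
Implicit Types p q : sqpair T1 R.

Let pull_fun_measurable p :
  measurable_fun setT (pfun p \o g : T2 -> borelC R).
Proof. by apply: measurableT_comp => //; exact: pfun_measurable. Qed.

Let pull_fun_square p :
  (\int[tm (pmeas p)]_y (normc ((pfun p \o g) y) ^+ 2)%:E < +oo)%E.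
Proof.
have mp : measurable_fun setT (fun x => normc (pfun p x) ^+ 2).
  exact/measurable_sqr_normc/pfun_measurable.
rewrite (ge0_integral_transport _ (h := fun y => normc (pfun p (g y)) ^+ 2)) //;
  first last.
- by move=> y; exact: sqr_ge0.
- exact: (measurableT_comp mp).
(* On [D] the integrand is that of [p], since [g] undoes [f] there; enlarging [D] to the whole space
   bounds the integral by the finite one of [p]. *)
apply: le_lt_trans (pfun_square p); rewrite preimage_setT setTI.
rewrite [X in (X <= _)%E](eq_integral (fun x => (normc (pfun p x) ^+ 2)%:E)).
  apply: ge0_subset_integral => //; first exact/measurable_EFinP.
  by move=> x _; rewrite lee_fin sqr_ge0.
by move=> x /set_mem Dx; rewrite fK.
Qed.

Definition transport_pair p : sqpair T2 R :=
  SqPair (pull_fun_measurable p) (pull_fun_square p).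

Lemma dominates_transport_pair p la :
  pmeas p `<< la -> pmeas (transport_pair p) `<< tm la.
Proof. exact: dominates_transport. Qed.

Lemma dens_transport p la : pmeas p `<< la ->
  \forall y \ae tm la,
    dens (transport_pair p) (tm la) y = dens p la (g y).
Proof. by move=> pl; apply: filterS (rnsqrt_transport pl) => y h; rewrite /dens h. Qed.

Definition htransport (u : hspace T1 R) : hspace T2 R :=
  hclass (transport_pair (hrepr u)).

(** Well-definedness: densities of equivalent pairs agree almost everywhere for [la], and
    [transport_ae] carries this agreement along [g]. *)
Lemma htransport_class p : htransport (hclass p) = hclass (transport_pair p).
Proof.
rewrite /htransport.
have [la [pl rl]] := dominating2 p (hrepr (hclass p)).
apply/(hclass_eq (dominates_transport_pair rl) (dominates_transport_pair pl)).
apply: filterS3 (dens_transport pl) (dens_transport rl)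
  (transport_ae (dens_repr pl rl)) => y.
by move=> -> -> ->.
Qed.

Lemma htransport_is_linear : linear htransport.
Proof.
move=> c u v; rewrite -(hreprK u) -(hreprK v); move: (hrepr u) (hrepr v) => p q.
rewrite [_ *: hclass p](hscale_class c p) [_ + _](hadd_class _ q).
rewrite !htransport_class [_ *: _](hscale_class c _) [_ + _](hadd_class _ _).
have [la [pl ql]] := dominating2 p q.
have cpl := dominates_scale c pl.
have tp := dominates_transport_pair pl; have tq := dominates_transport_pair ql.
have ctp := dominates_scale c tp.
apply/(hclass_eq (dominates_transport_pair (dominates_add_sqpair cpl ql))
  (dominates_add_sqpair ctp tq)).
apply: filterS2 (filterI (dens_transport (dominates_add_sqpair cpl ql))
   (transport_ae (dens_add cpl ql)))
  (filterI (dens_add ctp tq) (filterI (dens_transport pl) (dens_transport ql))).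
by move=> y [-> ->] [-> [h1 h2]]; rewrite !dens_scale h1 h2.
Qed.

HB.instance Definition _ := GRing.isLinear.Build R[i] (hspace T1 R) (hspace T2 R)
  *:%R htransport htransport_is_linear.

End transport_pair.
End transport_measure.

(** * Criteria for equality, orthogonality and finite sums of classes *)

Section hspace_tools.
Context d (T : measurableType d) (R : realType).
Implicit Types (p q : sqpair T R) (la : {finite_measure set T -> \bar R}).

(** The measures need only agree on measurable sets, so one is not rewritten into the other;
    uniqueness of the derivative identifies their densities with respect to [pmeas p]. *)
Lemma hclass_ext p q :
  (forall A, measurable A -> pmeas p A = pmeas q A) ->
  (\forall x \ae pmeas p, pfun p x = pfun q x) -> hclass p = hclass q.
Proof.
move=> pqE pqf.
have qp : pmeas q `<< pmeas p.
  by apply/null_content_dominatesP => A mA; rewrite -(pqE A mA).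
have pp : pmeas p `<< pmeas p by [].
apply/(hclass_eq pp qp).
have : \forall x \ae pmeas p,
    rnsqrt (pmeas q) (pmeas p) x = rnsqrt (pmeas p) (pmeas p) x.
  apply: rnsqrt_unique; first exact: measurable_rnsqrt.
    by move=> x; exact: sqrtr_ge0.
  move=> A mA; rewrite -(pqE A mA).
  rewrite (Radon_Nikodym_SigmaFinite.f_integral pp) //.
  apply: ge0_ae_eq_integral => //.
  - exact/measurable_funTS/measurable_rn.
  - exact/measurable_funTS/measurable_EFinP/measurable_funX/measurable_rnsqrt.
  - by move=> x _; exact: Radon_Nikodym_SigmaFinite.f_ge0.
  - by move=> x _; rewrite lee_fin sqr_ge0.
  - by apply: filterS (rnsqrt_ae pp) => x ->.
by apply: filterS2 pqf => x; rewrite /dens => -> ->.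
Qed.

Lemma hdot_disjoint p q (A B : set T) : measurable A -> measurable B ->
  pmeas p (~` A) = 0%E -> pmeas q (~` B) = 0%E -> A `&` B = set0 ->
  hdot (hclass p) (hclass q) = 0.
Proof.
move=> mA mB pA qB AB0; have [la [pl ql]] := dominating2 p q.
(* A measure carried by [C] has a density that vanishes [la]-almost everywhere off [C]; for disjoint
   [A] and [B] the product of the two densities is then zero almost everywhere. *)
have support r (C : set T) : measurable C -> pmeas r `<< la ->
    pmeas r (~` C) = 0%E -> \forall x \ae la, rnsqrt (pmeas r) la x != 0 -> C x.
  move=> mC rl rC; apply/(ae_rnsqrt_neq0 _ rl); exists (~` C).
  by split => //; exact: measurableC.
rewrite (hdot_class pl ql) sqdotE.
rewrite (ae_eq_cintegral (g := fun=> 0)) //; first last.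
- apply: filterS2 (support p A mA pl pA) (support q B mB ql qB) => x.
  rewrite /dens.
  have [->|_ /(_ isT) Ax] := eqVneq (rnsqrt (pmeas p) la x) 0.
    by rewrite mulr0 conjc0 mul0r.
  have [->|_ /(_ isT) Bx] := eqVneq (rnsqrt (pmeas q) la x) 0.
    by rewrite !mulr0.
  by have : (A `&` B) x by []; rewrite AB0.
- exact: measurable_dot_dens.
by rewrite /cintegral /= Rintegral_cst // mul0r.
Qed.

(** Reduces an identity between sums of classes to a pointwise identity of densities over one
    dominating measure. *)
Lemma hclass_sum la (I : Type) (s : seq I) (p : I -> sqpair T R) :
  (forall i, pmeas (p i) `<< la) ->
  exists q, [/\ hclass q = \sum_(i <- s) hclass (p i), pmeas q `<< la &
    \forall x \ae la, dens q la x = \sum_(i <- s) dens (p i) la x].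
Proof.
move=> pl; elim: s => [|i s [q [qE ql qd]]].
  exists (zero_sqpair T R); split.
  - by rewrite big_nil.
  - exact: dominates_zero.
  - by apply: aeW => x; rewrite big_nil dens_zero.
exists (add_sqpair (p i) q); split.
- by rewrite big_cons -qE -hadd_class.
- exact: dominates_add_sqpair.
- by apply: filterS2 (dens_add (pl i) ql) qd => x -> ->; rewrite big_cons.
Qed.

End hspace_tools.

(** * Preservation of the inner product when [D] is the whole space *)

Section isometry.
Context d1 d2 (T1 : measurableType d1) (T2 : measurableType d2) (R : realType).
Context (f : T1 -> T2) (g : T2 -> T1).
Hypotheses (mf : measurable_fun setT f) (mg : measurable_fun setT g).
Hypothesis fK : forall x, [set: T1] x -> g (f x) = x.

Lemma Rintegral_transport (la : {finite_measure set T1 -> \bar R}) (h : T1 -> R) :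
  la.-integrable setT (EFin \o h) ->
  \int[transport mf measurableT la]_y h (g y) = \int[la]_x h x.
Proof.
move=> hi; rewrite /Rintegral; congr fine.
have hfg : (EFin \o (h \o g)) \o f = EFin \o h.
  by apply/funext => x /=; rewrite fK.
(* Restriction to the whole space is dropped, leaving a plain image measure, for which the change of
   variables also covers integrands of variable sign. *)
rewrite (eq_measure_integral (pushforward la f)); last first.
  by move=> A mA _; rewrite /= /transport /pushforward /mrestr setIT.
rewrite (integral_pushforward mf (f := EFin \o (h \o g))) //.
- by rewrite preimage_setT hfg.
- apply/measurable_EFinP; apply: measurableT_comp => //.
  by apply/measurable_EFinP; exact: measurable_int hi.
- by rewrite preimage_setT hfg.
Qed.

(** Over the image of [la] the integrand is the original one composed with [g], and integrating
    against the image under [f] cancels [g]. *)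
Lemma hdot_htransport (u v : hspace T1 R) :
  hdot (htransport mf measurableT mg fK u) (htransport mf measurableT mg fK v) =
  hdot u v.
Proof.
rewrite -(hreprK u) -(hreprK v) !htransport_class.
move: (hrepr u) (hrepr v) => p q; have [la [pl ql]] := dominating2 p q.
have tp : pmeas (transport_pair mf measurableT mg fK p) `<< transport mf measurableT la.
  exact: dominates_transport_pair.
have tq : pmeas (transport_pair mf measurableT mg fK q) `<< transport mf measurableT la.
  exact: dominates_transport_pair.
rewrite (hdot_class tp tq) (hdot_class pl ql) !sqdotE.
have [iR iI] := cintegrable_dens pl ql.
rewrite (ae_eq_cintegral
  (g := fun y => conjc (dens p la (g y)) * dens q la (g y))).
- by rewrite /cintegral (Rintegral_transport iR) (Rintegral_transport iI).
- exact: measurable_dot_dens.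
- by apply: (measurableT_comp (measurable_dot_dens pl ql)).
- by apply: filterS2 (dens_transport mf measurableT mg fK pl)
    (dens_transport mf measurableT mg fK ql) => y -> ->.
Qed.

End isometry.

(** * The Cuntz relations, for measurable maps with measurable ranges *)

Section cuntz.
Context d (T : measurableType d) (R : realType) (N : nat).
Context (s : T -> T) (t : 'I_N -> T -> T).
Hypotheses (ms : measurable_fun setT s) (mt : forall i, measurable_fun setT (t i)).
Hypothesis mrange : forall i, measurable (range (t i)).
Hypothesis stK : forall i x, s (t i x) = x.
Hypothesis t_disjoint :
  forall i j, i != j -> range (t i) `&` range (t j) = set0.
Hypothesis t_cover : \bigcup_(i in [set: 'I_N]) range (t i) = setT.

Let tK i x : setT x -> s (t i x) = x.
Proof. by move=> _; exact: stK. Qed.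

Let sK i x : range (t i) x -> t i (s x) = x.
Proof. by move=> [y _ <-]; rewrite stK. Qed.

Definition cuntz_isometry i : {linear hspace T R -> hspace T R} :=
  htransport (mt i) measurableT ms (@tK i).

Definition cuntz_adjoint i : {linear hspace T R -> hspace T R} :=
  htransport ms (mrange i) (mt i) (@sK i).

Local Notation S := cuntz_isometry.
Local Notation S' := cuntz_adjoint.

Lemma cuntz_isometry_class i (p : sqpair T R) :
  exists q : sqpair T R,
    [/\ pfun q = pfun p \o s,
        (forall E, measurable E -> pmeas q E = pmeas p (t i @^-1` E)) &
        S i (hclass p) = hclass q].
Proof.
exists (transport_pair (mt i) measurableT ms (@tK i) p); split => //.
- by move=> E _; rewrite /= /transport /pushforward /mrestr setIT.
- exact: htransport_class.
Qed.

Lemma hdot_cuntz_isometry i u v : hdot (S i u) (S i v) = hdot u v.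
Proof. exact: hdot_htransport. Qed.

(** The measure of [S k u] is carried by [range (t k)], as no point is sent by [t k] outside that
    range; distinct ranges are disjoint. *)
Lemma hdot_cuntz_isometry_neq i j u v : i != j -> hdot (S i u) (S j v) = 0.
Proof.
move=> ij; rewrite -(hreprK u) -(hreprK v) /= !htransport_class.
have supp k p : pmeas (transport_pair (mt k) measurableT ms (@tK k) p)
    (~` range (t k)) = 0%E.
  rewrite /= /transport /pushforward /mrestr setIT.
  rewrite (_ : _ @^-1` _ = set0) ?measure0 //.
  by apply/seteqP; split => // x; apply; exists x.
apply: (hdot_disjoint (mrange i) (mrange j)).
- exact: supp.
- exact: supp.
- exact: t_disjoint.
Qed.

(** For equal indices both the measure and the function return to their original values. Otherwise
    [t j] never meets [range (t i)], so the resulting measure is zero. *)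
Lemma cuntz_adjointK i j u : S' i (S j u) = if i == j then u else 0.
Proof.
rewrite -(hreprK u) /= !htransport_class; move: (hrepr u) => p.
case: eqVneq => [<-|ij].
  apply: hclass_ext => [A mA|].
    rewrite /= /transport /pushforward /mrestr /=; congr (pmeas p _).
    apply/seteqP; split => [x /= [[] ]|x Ax /=]; first by rewrite stK.
    by rewrite stK; split => //; split => //; exists x.
  by apply: aeW => x /=; rewrite stK.
have null A : (t j @^-1` (s @^-1` A `&` range (t i))) = set0.
  apply/seteqP; split => // x [_ tx].
  suff : (range (t i) `&` range (t j)) (t j x) by rewrite t_disjoint.
  by split => //; exists x.
have nullE A : transport ms (mrange i)
    (transport (mt j) measurableT (pmeas p)) A = 0%E.
  by rewrite /= /transport /pushforward /mrestr /= setIT null measure0.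
apply: (@hclass_ext _ _ _ _ (zero_sqpair T R)) => [A mA|].
  exact: nullE.
(* For the zero measure the whole space is a null set, so the functions agree almost everywhere
   whatever their values. *)
by exists setT; split => //; exact: nullE.
Qed.

Lemma cuntz_sum u : \sum_(i < N) S i (S' i u) = u.
Proof.
rewrite -(hreprK u); move: (hrepr u) => q.
pose p i := transport_pair (mt i) measurableT ms (@tK i)
  (transport_pair ms (mrange i) (mt i) (@sK i) q).
(* On [range (t i)] the map [t i \o s] is the identity, so taking images under [s] and then [t i]
   only restricts the measure. *)
have pE i A : pmeas (p i) A = mrestr (pmeas q) (mrange i) A.
  rewrite /= /transport /pushforward /mrestr /= setIT; congr (pmeas q _).
  by apply/seteqP; split => x /= [Ax Kx]; split; rewrite //= ?sK // in Ax *.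
have pq i : pmeas (p i) `<< pmeas q.
  apply/null_content_dominatesP => A mA qA.
  rewrite pE; have /null_content_dominatesP :=
    dominates_mrestr (la := pmeas q) (mrange i).
  exact.
have qq : pmeas q `<< pmeas q by [].
transitivity (\sum_(i < N) hclass (p i)).
  by apply: eq_bigr => i _; rewrite /= !htransport_class.
have [r [<- rq rd]] := hclass_sum (index_enum 'I_N) pq.
apply/(hclass_eq rq qq).
have one : \forall x \ae pmeas q, rnsqrt (pmeas q) (pmeas q) x = 1.
  have := @rnsqrt_indic _ _ _ (pmeas q) (pmeas q) setT measurableT.
  have muE A : measurable A -> pmeas q A = pmeas q (A `&` setT) by rewrite setIT.
  by move=> /(_ muE); apply: filterS => x ->; rewrite indicT.
(* Finitely many indices allow a single exceptional null set for all densities. *)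
have inds : \forall x \ae pmeas q, forall i,
    rnsqrt (pmeas (p i)) (pmeas q) x = \1_(range (t i)) x.
  by apply: filter_forall => i; apply: rnsqrt_indic => // A _; exact: pE.
apply: filterS3 rd one inds => x -> x1 xi.
(* The ranges partition the space, so only the summand of the range containing [x] survives. *)
have [k _ kx] : (\bigcup_(i in [set: 'I_N]) range (t i)) x by rewrite t_cover.
rewrite (bigD1 k) //= big1 ?addr0 => [|j jk].
  by rewrite /dens x1 xi indicE mem_set //= sK.
rewrite /dens xi indicE memNset ?mulr0 // => jx.
suff : (range (t j) `&` range (t k)) x by rewrite t_disjoint.
by [].
Qed.

Lemma cuntz_adjointP i : is_adjoint (S i) (S' i).
Proof.
move=> u v; rewrite -{1}(cuntz_sum v).
have hdot_sum w (F : 'I_N -> hspace T R) :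
    hdot w (\sum_(j < N) F j) = \sum_(j < N) hdot w (F j).
  apply: (big_morph (hdot w) (id1 := 0) (op1 := +%R)); first exact: hdotDr.
  (* The zero vector is written as [0 *: w] so that linearity gives a zero product. *)
  by rewrite -(scale0r w) hdotZr mul0r.
rewrite hdot_sum (bigD1 i) //= big1 ?addr0; last first.
  by move=> j ji; apply: hdot_cuntz_isometry_neq; rewrite eq_sym.
exact: hdot_cuntz_isometry.
Qed.

End cuntz.

(** * From topology to Borel measurability, and the theorem *)

Lemma continuous_borel_measurable (X Y : ptopologicalType) (f : X -> Y) :
  continuous f -> measurable_fun setT (f : borelType X -> borelType Y).
Proof.
move=> cf.
apply: (@measurability _ _ (borelType X) (borelType Y) setT f (@open Y)) => //.
move=> _ [U oU <-]; rewrite setTI; apply: sub_sigma_algebra.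
by apply: open_comp => // x _; exact: cf.
Qed.

(** A compact image in a Hausdorff space is closed. This makes the sets [range (tau i)] admissible
    as the domains [D] of the adjoints. *)
Lemma compact_range_borel (X Y : ptopologicalType) (f : X -> Y) :
  compact [set: X] -> hausdorff_space Y -> continuous f ->
  measurable (range f : set (borelType Y)).
Proof.
move=> cX hY cf.
have cl : closed (range f).
  apply: compact_closed => //; apply: continuous_compact => //.
  exact: continuous_subspaceT.
rewrite -(setCK (range f)); apply: measurableC; apply: sub_sigma_algebra.
exact: closed_openC.
Qed.

(** Well-definedness is expressed by requiring the formula for [S i] at every representative [p],
    not just at a chosen one. *)
Theorem mainTheorem2 (R : realType) (N : nat) (X : ptopologicalType)
    (sigma : X -> X) (tau : 'I_N -> X -> X)
    (N_ge2 : (2 <= N)%N)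
    (X_compact : compact [set: X]) (X_hausdorff : hausdorff_space X)
    (sigma_continuous : continuous sigma)
    (tau_continuous : forall i, continuous (tau i))
    (sigma_tau : forall i, sigma \o tau i = id)
    (tau_disjoint : forall i j, i != j -> range (tau i) `&` range (tau j) = set0)
    (tau_cover : \bigcup_(i in [set: 'I_N]) range (tau i) = [set: X]) :
  exists S : 'I_N -> {linear calH R X -> calH R X},
    [/\ (forall (i : 'I_N) (p : sqpair (borelType X) R),
          exists q : sqpair (borelType X) R,
            [/\ pfun q = pfun p \o sigma,
                (forall E : set (borelType X), measurable E ->
                   pmeas q E = pmeas p (tau i @^-1` E)) &
                S i (hclass p) = hclass q]),
        (forall i u, hnorm (S i u) = hnorm u) &
        exists Sadj : 'I_N -> {linear calH R X -> calH R X},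
          [/\ (forall i, is_adjoint (S i) (Sadj i)),
              (forall i j u, Sadj i (S j u) = if i == j then u else 0) &
              (forall u, \sum_(i < N) S i (Sadj i u) = u)]].
Proof.
have ms := continuous_borel_measurable sigma_continuous.
have mt i := continuous_borel_measurable (tau_continuous i).
have mK i := compact_range_borel X_compact X_hausdorff (tau_continuous i).
have st i x : sigma (tau i x) = x by rewrite -[RHS]/(id x) -(sigma_tau i).
exists (@cuntz_isometry _ (borelType X) R N sigma tau ms mt st); split.
- by move=> i p; exact: cuntz_isometry_class.
- by move=> i u; rewrite /hnorm hdot_cuntz_isometry.
- exists (@cuntz_adjoint _ (borelType X) R N sigma tau ms mt mK st); split.
  + by move=> i; exact: cuntz_adjointP.
  + by move=> i j u; exact: cuntz_adjointK.
  + by move=> u; exact: cuntz_sum.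
Qed.
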